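(* Let $\lambda$ and $\mu$ be infinite cardinals with $\lambda^{<\mu}=\lambda$, and let $0<k<t\le 2k$ be natural numbers. Then $\chi_{\rm CF}(\lambda,t,k+1)\ge\mu$.
   Context: For a family $\mathcal A$ and cardinal $\rho$, $f:\bigcup\mathcal A\to\rho$ is a conflict free coloring of $\mathcal A$ if for every $A\in\mathcal A$ some $\zeta<\rho$ has $|A\cap f^{-1}\{\zeta\}|=1$; $\chi_{\rm CF}(\mathcal A)$ is the least such $\rho$. A $(\lambda,\kappa,\mu)$-system is a family of $\lambda$ sets each of size $\kappa$, distinct members meeting in fewer than $\mu$ points; $\chi_{\rm CF}(\lambda,\kappa,\mu)$ is the supremum of $\chi_{\rm CF}(\mathcal A)$ over all $(\lambda,\kappa,\mu)$-systems. *)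

(* Defs.v *)
From mathcomp Require Import all_boot.
Set Implicit Arguments. Unset Strict Implicit. Unset Printing Implicit Defensive.

Definition card_le (A B : Type) : Prop := exists f : A -> B, injective f.
Definition card_lt (A B : Type) : Prop := card_le A B /\ ~ card_le B A.
Definition infinite_type (A : Type) : Prop := ~ exists n : nat, card_le A 'I_n.

(* lambda^{<mu} = lambda, with lambda = |L|, mu = |M|:
   for every cardinal nu < mu, lambda^nu = |N -> L| <= lambda
   (the reverse inequality is automatic). *)
Definition pow_lt_eq (L M : Type) : Prop :=
  forall N : Type, card_lt N M -> card_le (N -> L) L.

Definition has_card (X : Type) (S : X -> Prop) (n : nat) : Prop :=
  exists f : 'I_n -> X, injective f /\ (forall x, S x <-> exists i, f i = x).

Definition is_system (L X : Type) (A : L -> X -> Prop) (t m : nat) : Prop :=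
  injective A /\
  (forall i, has_card (A i) t) /\
  (forall i j, i <> j -> exists p, p < m /\ has_card (fun x => A i x /\ A j x) p).

(* f : X -> C is a conflict-free colouring of the family A
   (X is the ground set bigcup A). *)
Definition cf_coloring (L X C : Type) (A : L -> X -> Prop) (f : X -> C) : Prop :=
  forall i, exists z : C, has_card (fun x => A i x /\ f x = z) 1.

(* Main.v *)
Require Import Defs.
From mathcomp Require Import all_boot.
From mathcomp Require Import boolp wochoice.

(** Put j = t - k <= k and D = C^j * k. The points lie on levels a in L, where L carries a
    total asymmetric relation [lt] (transitivity plays no role). A layer at level a consists of
    j new points of level a together with a guess r, a map from D to points; besides this, it
    carries a label d : C -> L, which only serves to have many layers with the same guess. For
    every p in C^j such that r (p, _) enumerates k points of level below a that occur nowhere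
    else in r, the family contains the set of the j new points and the k points r (p, i). Two
    such sets of the same layer share only new points, and two sets of different layers share
    only old points of one of them.

    Let f colour the points. Call a colour relevant at a if it occurs |L| times below a. If r
    picks old points of colours (p_0, ..., p_(j-1), p_0, ..., p_0) for every tuple p of relevant
    colours, and f is conflict free, then each layer with guess r has a new point of irrelevant
    colour: otherwise take p to be the colours of its new points. Hence some colour z_a that is
    irrelevant at a occurs |L| times at level a, and so is relevant at all b with lt a b. Thus
    a |-> z_a is an injection of L into C, which is impossible since |L^C| <= |L|. *)

Set Implicit Arguments.
Unset Strict Implicit.
Unset Printing Implicit Defensive.

(** * Injections, powers and Cantor's theorem *)

Lemma card_le_trans (A B D : Type) : card_le A B -> card_le B D -> card_le A D.
Proof. by move=> [f fI] [g gI]; exists (g \o f); apply: inj_comp. Qed.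

Lemma card_le_codomain (E A B : Type) : card_le A B -> card_le (E -> A) (E -> B).
Proof.
move=> [f fI]; exists (fun g => f \o g) => g g' eq_fg.
by apply/funext => x; apply: fI; apply: (congr1 (@^~ x) eq_fg).
Qed.

Lemma card_le_domain (L E F : Type) :
  inhabited L -> card_le E F -> card_le (E -> L) (F -> L).
Proof.
move=> [l0] [e eI].
exists (fun g y => if pselect (exists x, e x = y) is left ex then g (projT1 (cid ex))
                   else l0) => g g' eq_g.
apply/funext => x; have := congr1 (@^~ (e x)) eq_g; rewrite /=.
case: pselect => [ex|[]]; last by exists x.
by case: cid => x' /= /eI ->.
Qed.

Lemma card_le_sig (T : Type) (P : T -> Prop) : card_le {x | P x} T.
Proof. by exists sval => -[x Px] [y Py] /= exy; apply: eq_exist. Qed.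

(** An injection from ['I_n] misses a value, which serves the next index: otherwise choosing
    preimages would inject [A] into ['I_n]. *)
Lemma infinite_card_ord (A : Type) (n : nat) : infinite_type A -> card_le 'I_n A.
Proof.
move=> Ainf; elim: n => [|n [f fI]]; first by exists (fun i : 'I_0 => False_rect A (notF (ltn_ord i))) => -[].
have [x fx] : exists x, forall i, f i <> x.
  apply: contrapT => nx; apply: Ainf; exists n.
  have surj x : exists i, f i = x.
    by apply: contrapT => nfx; apply: nx; exists x => i fix_; apply: nfx; exists i.
  have [g gK] := choice surj; exists g => x y exy.
  by rewrite -(gK x) -(gK y) exy.
exists (fun i => if unlift ord_max i is Some i' then f i' else x) => i i'.
case: unliftP => [a|] ->; case: unliftP => [b|] -> //.
- by move/fI ->.
- by move/fx.
- by move/esym/fx.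
Qed.

Lemma infinite_neq (A : Type) : infinite_type A -> exists a b : A, a <> b.
Proof.
move=> /(@infinite_card_ord A 2) [f fI]; exists (f ord0), (f ord_max).
by move/fI.
Qed.

Lemma infinite_card_lt_ord (A : Type) (n : nat) : infinite_type A -> card_lt 'I_n A.
Proof.
by move=> Ainf; split; [exact: infinite_card_ord | move=> h; apply: Ainf; exists n].
Qed.

Section Exponents.
Context (L : Type) (L2 : exists a b : L, a <> b).

Let L1 : inhabited L.
Proof. by have [a _] := L2; exists. Qed.

Lemma pow_le_prod (E F : Type) :
  card_le (E -> L) L -> card_le (F -> L) L -> card_le (E * F -> L) L.
Proof.
move=> EL FL; apply: card_le_trans EL.
apply: (@card_le_trans _ (E -> F -> L)); last exact: card_le_codomain.
exists (fun g x y => g (x, y)) => g g' eq_g.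
by apply/funext => -[x y]; apply: (congr1 (fun h => h x y) eq_g).
Qed.

Lemma pow_le_card (E : Type) : card_le (E -> L) L -> card_le E L.
Proof.
apply: card_le_trans; have [a [b neq_ab]] := L2.
exists (fun x y => if pselect (x = y) then a else b) => x y /(congr1 (@^~ y)) /=.
by case: pselect => //= _; case: pselect => //= _ /esym.
Qed.

(** Diagonal argument: the two injections compose to an injective [F : (E -> L) -> E], and [g] is
    chosen to differ at [y] from the only function that [F] may send to [y]. *)
Lemma pow_le_Cantor (E : Type) : card_le (E -> L) L -> ~ card_le L E.
Proof.
move=> /card_le_trans EL /EL [F FI].
have diag y : exists l : L, forall g, F g = y -> l <> g y.
  have [a [b neq_ab]] := L2.
  have [[g Fg]|ng] := pselect (exists g, F g = y); last first.
    by exists a => g Fg; case: ng; exists g.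
  have eq_g g' : F g' = y -> g' = g by move=> Fg'; apply: FI; rewrite Fg.
  have [eq_a|neq_a] := pselect (g y = a).
    by exists b => g' /eq_g ->; rewrite eq_a => /esym.
  by exists a => g' /eq_g -> /esym.
have [g gP] := choice diag.
exact: (gP (F g) g erefl erefl).
Qed.

Context (L_ord : forall n, card_le ('I_n -> L) L).

Lemma card_le_prod (A B : Type) : card_le A L -> card_le B L -> card_le (A * B) L.
Proof.
move=> [f fI] [g gI]; apply: card_le_trans (L_ord 2).
exists (fun ab (i : 'I_2) => if i == ord0 then f ab.1 else g ab.2) => -[a b] [a' b'] eqf.
congr pair; first by apply: fI; apply: (congr1 (@^~ ord0) eqf).
by apply: gI; apply: (congr1 (@^~ ord_max) eqf).
Qed.

Lemma pow_le_tuple (E : Type) (n : nat) :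
  card_le (E -> L) L -> card_le (('I_n -> E) -> L) L.
Proof.
move=> EL; elim: n => [|n IHn].
  apply: card_le_trans (L_ord 1); apply: card_le_domain => //.
  by exists (fun=> ord0) => g g' _; apply/funext => -[].
apply: card_le_trans (pow_le_prod EL IHn); apply: card_le_domain => //.
exists (fun g => (g ord_max, fun i => g (lift ord_max i))) => g g' [eq_max eq_lift].
apply/funext => i; case: (unliftP ord_max i) => [i'|] -> //.
exact: (congr1 (@^~ i') eq_lift).
Qed.

End Exponents.

(** The strict part of a well-ordering of [T]. *)
Lemma exists_tournament (T : Type) : exists lt : T -> T -> Prop,
  (forall x y, lt x y -> ~ lt y x) /\ (forall x y, x <> y -> lt x y \/ lt y x).
Proof.
have [R Rwo] := well_ordering_principle {classic T}.
have RwoT : wo_chain R predT by move=> A _; apply: Rwo.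
have Rtot x y : R x y || R y x by exact: (wo_chainW RwoT).
have Ranti x y : R x y && R y x -> x = y by exact: (wo_chain_antisymmetric RwoT).
exists (fun x y => R x y /\ x <> y); split=> [x y [Rxy neq] [Ryx _]|x y neq].
  by apply: neq; apply: Ranti; rewrite Rxy.
by case/orP: (Rtot x y) => Rxy; [left | right]; split=> // /esym.
Qed.

(** * Finite sets, and families completed to systems *)

Section HasCard.
Context (X : Type).
Implicit Type S : X -> Prop.

Lemma has_card_le S S' n m :
  (forall x, S x -> S' x) -> has_card S n -> has_card S' m -> n <= m.
Proof.
move=> SS' [f [fI fS]] [g [gI gS]].
have fg i : exists j, g j = f i by apply/gS/SS'/fS; exists i.
have [h hP] := choice fg.
suff /leq_card : injective h by rewrite !card_ord.
by move=> i i' eq_h; apply: fI; rewrite -!hP eq_h.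
Qed.

Lemma has_card_sub_range S n (g : 'I_n -> X) :
  (forall x, S x -> exists i, g i = x) -> exists2 p, p <= n & has_card S p.
Proof.
move=> gS; pose h : 'I_n -> {classic X} := g.
pose s := @undup {classic X} [seq x <- codom h | `[< S x >] ].
exists (size s).
  by rewrite (leq_trans (size_undup _)) // size_filter (leq_trans (count_size _ _)) // size_codom card_ord.
exists (tnth (in_tuple s)); split.
  exact: (elimT (tuple_uniqP (in_tuple s)) (undup_uniq _)).
move=> x; have -> : S x <-> (x : {classic X}) \in s.
  rewrite mem_undup mem_filter; split; last by case/andP => /asboolP.
  move=> Sx; apply/andP; split; first exact/asboolP.
  by have [i <-] := gS x Sx; apply: (codom_f h).
split=> [/(tnthP (in_tuple s)) [i ->]|[i <-]]; first by exists i.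
exact: mem_tnth (in_tuple s).
Qed.

Lemma has_card1 S : has_card S 1 <-> exists x, S x /\ forall y, S y -> y = x.
Proof.
split=> [[f [fI fS]]|[x [Sx Suniq]]].
  exists (f ord0); split; first by apply/fS; exists ord0.
  by move=> y /fS [i <-]; rewrite (ord1 i).
exists (fun=> x); split=> [i i' _|y]; first by rewrite (ord1 i) (ord1 i').
by split=> [/Suniq ->|[_ <-]] //; exists ord0.
Qed.

Lemma has_card0 S : (forall x, ~ S x) -> has_card S 0.
Proof.
move=> S0; exists (fun i : 'I_0 => False_rect X (notF (ltn_ord i))).
by split=> [[]|x] //; split=> [/S0|[[]]].
Qed.

Lemma has_card_sig (P : X -> Prop) S n :
  (forall x, S x -> P x) -> has_card S n ->
  has_card (fun y : {x | P x} => S (sval y)) n.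
Proof.
move=> SP [f [fI fS]].
have Sf i : P (f i) by apply/SP/fS; exists i.
exists (fun i => exist _ (f i) (Sf i)); split=> [i i' [/fI //]|[x Px] /=].
rewrite fS; split=> -[i fi]; exists i; last by case: fi.
exact: eq_exist.
Qed.

End HasCard.

(** Passes from a family indexed by some [Q] no larger than [L], which may leave points of [X]
    uncovered, to one indexed by [L] that covers its ground type. A colouring of the latter
    restricts to one of [B]. *)
Lemma extend_system (L Q X C : Type) (B : Q -> X -> Prop) (t k : nat) :
  inhabited L -> card_le Q L -> k < t ->
  (forall q, has_card (B q) t) ->
  (forall q q', q <> q' -> exists2 p, p <= k & has_card (fun x => B q x /\ B q' x) p) ->
  ~ (exists f : X -> C, cf_coloring B f) ->
  exists (Y : Type) (A : L -> Y -> Prop),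
    is_system A t k.+1 /\ (forall y, exists l, A l y) /\ ~ exists f : Y -> C, cf_coloring A f.
Proof.
move=> [l0] [e eI] lt_kt Bt Bk Bncf.
(* Indices of [L] that code no member of the family get pairwise disjoint fresh sets. *)
pose A0 l (y : X + L * 'I_t) := match y with
  | inl x => exists q, e q = l /\ B q x
  | inr z => z.1 = l /\ ~ exists q, e q = l
  end.
have A0t l : has_card (A0 l) t.
  have [[q <-]|nq] := pselect (exists q, e q = l).
    have [f [fI fB]] := Bt q; exists (fun i => inl (f i)); split=> [i i' [/fI //]|[x|z]] /=.
      split=> [[q' [/eI -> /fB [i <-]]]|[i [<-]]]; first by exists i.
      by exists q; split=> //; apply/fB; exists i.
    by split=> [[_ []]|[i]] //; exists q.
  exists (fun i => inr (l, i)); split=> [i i' [//]|[x|[l' i]]] /=.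
    by split=> [[q [eq_l _]]|[i]] //; case: nq; exists q.
  by split=> [[<- _]|[i' [<- _]]] //; exists i.
have A0k l l' : l <> l' -> exists2 p, p <= k & has_card (fun y => A0 l y /\ A0 l' y) p.
  move=> neq_l.
  have [[q Eq]|nq] := pselect (exists q, e q = l); last first.
    exists 0 => //; apply: has_card0 => -[x|z] /=.
      by case=> -[q [eq_l _]] _; case: nq; exists q.
    by case=> -[El _] [El' _]; case: neq_l; rewrite -El.
  have [[q' Eq']|nq] := pselect (exists q, e q = l'); last first.
    exists 0 => //; apply: has_card0 => -[x|z] /=.
      by case=> _ [q' [eq_l _]]; case: nq; exists q'.
    by case=> -[El _] [El' _]; case: neq_l; rewrite -El.
  have [p le_pk [f [fI fB]]] : exists2 p, p <= k & has_card (fun x => B q x /\ B q' x) p.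
    by apply: Bk => eq_q; apply: neq_l; rewrite -Eq -Eq' eq_q.
  exists p => //; exists (fun i => inl (f i)); split=> [i i' [/fI //]|[x|z]] /=.
    rewrite -Eq -Eq'; split=> [[[q1 [/eI -> B1]] [q2 [/eI -> B2]]]|[i [<-]]].
      by have /fB [i <-] := conj B1 B2; exists i.
    have /fB [B1 B2] : exists i', f i' = f i by exists i.
    by split; [exists q | exists q'].
  by split=> [[[El _] [El' _]]|[i]] //; case: neq_l; rewrite -El.
pose Y := {y | exists l, A0 l y}; pose A l (y : Y) := A0 l (sval y).
have At l : has_card (A l) t by apply: has_card_sig => // y; exists l.
have Ak l l' : l <> l' -> exists p, p < k.+1 /\ has_card (fun y => A l y /\ A l' y) p.
  move=> /A0k [p le_pk Ap]; exists p; split=> //.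
  by apply: (@has_card_sig _ (fun y => exists l, A0 l y) _ _ _ Ap) => y [Aly _]; exists l.
exists Y, A; split; last split; last 1 first.
- move=> [f fA]; apply: Bncf.
  (* A default colour for the points of [X] that lie in no set. *)
  have [z0 _] := fA l0.
  pose g x := if pselect (exists l, A0 l (inl x)) is left ex then f (exist _ (inl x) ex) else z0.
  have gE x ex : g x = f (exist _ (inl x) ex).
    by rewrite /g; case: pselect => // ex'; congr f; apply: eq_exist.
  exists g => q; have [z /has_card1 [[[x|y] ex] [[Ay fy] uniq_y]]] := fA (e q); last first.
    by case: Ay => _ []; exists q.
  exists z; apply/has_card1; exists x; rewrite gE; split.
    by split=> //; case: Ay => q' [/eI <-].
  move=> x' [Bx' gx']; have ex' : exists l, A0 l (inl x') by exists (e q), q.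
  have [] // : exist _ (inl x') ex' = exist _ (inl x) ex :> Y.
  by apply: uniq_y; rewrite -gE; split=> //; exists q.
- split; last by split.
  (* Equal sets would meet in [t > k] points. *)
  move=> l l' eq_A; apply: contrapT => /Ak [p [lt_pk Ap]].
  have : t <= p by apply: (has_card_le _ (At l) Ap) => y Aly; rewrite -eq_A.
  by rewrite leqNgt (leq_ltn_trans _ lt_kt).
- by move=> [y [l Aly]]; exists l.
Qed.

(** * The layered system *)

Section LayeredSystem.
Context (L C : Type) (lt : L -> L -> Prop) (j k : nat).
Context (lt_asym : forall x y, lt x y -> ~ lt y x).
Context (lt_total : forall x y, x <> y -> lt x y \/ lt y x).

Local Notation D := (('I_j -> C) * 'I_k)%type.
(** Level, code under [h] of the layer where the point is new, place in that layer. *)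
Local Notation X := (L * L * 'I_j)%type.
Local Notation layer := ((C -> L) * (D -> X))%type.

Context (h : layer -> L) (hI : injective h).

Definition index := (L * layer * ('I_j -> C))%type.

Implicit Type q : index.

Definition new_pt q (i : 'I_j) : X := (q.1.1, h q.1.2, i).

Definition old_pt q (i : 'I_k) : X := q.1.2.2 (q.2, i).

(** The levels keep old points apart from new ones; the second clause makes the old points distinct
    and, within one guess, disjoint for different tuples [q.2]. *)
Definition valid_index q := forall i,
  lt (old_pt q i).1.1 q.1.1 /\ forall b, q.1.2.2 b = old_pt q i -> b = (q.2, i).

Definition layered_set q (x : X) := (exists i, x = new_pt q i) \/ exists i, x = old_pt q i.

Let lt_irr x : ~ lt x x.
Proof. by move=> ltxx; apply: (lt_asym ltxx ltxx). Qed.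

Lemma layered_set_card q : valid_index q -> has_card (layered_set q) (j + k).
Proof.
move=> qV; pose f (s : 'I_j + 'I_k) := match s with inl i => new_pt q i | inr i => old_pt q i end.
exists (f \o split); split.
  apply: inj_comp; last exact: (can_inj (@splitK _ _)).
  move=> [i|i] [i'|i'] /=; first by case=> ->.
  - by move=> eq_x; have [] := qV i'; rewrite -eq_x => /lt_irr.
  - by move=> eq_x; have [] := qV i; rewrite eq_x => /lt_irr.
  - by move=> eq_x; have [_ /(_ _ eq_x) [->]] := qV i'.
move=> x; split=> [[[i ->]|[i ->]]|[i <-]].
- by exists (lshift k i); rewrite /= (unsplitK (inl i)).
- by exists (rshift j i); rewrite /= (unsplitK (inr i)).
- by rewrite /=; case: (split i) => i'; [left | right]; exists i'.
Qed.

(** At different levels, common points are old for the set whose level is the greater under [lt]; at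
    one level in different layers, old for both; in one layer, new. Each case leaves at most [k]
    points, as [j <= k]. *)
Lemma layered_set_inter q q' : j <= k -> valid_index q -> valid_index q' -> q <> q' ->
  exists2 p, p <= k & has_card (fun x => layered_set q x /\ layered_set q' x) p.
Proof.
move=> le_jk qV q'V neq_q.
suff [Sq|[Sq|Sq]] : (forall x, layered_set q x -> layered_set q' x -> exists i, old_pt q i = x) \/
    (forall x, layered_set q x -> layered_set q' x -> exists i, old_pt q' i = x) \/
    (forall x, layered_set q x -> layered_set q' x -> exists i, new_pt q i = x).
- by apply: (@has_card_sub_range _ _ k (old_pt q)) => x [/Sq]; exact.
- by apply: (@has_card_sub_range _ _ k (old_pt q')) => x [/Sq]; exact.
- have [p le_pj Sp] : exists2 p, p <= j & has_card (fun x => layered_set q x /\ layered_set q' x) p.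
    by apply: (@has_card_sub_range _ _ j (new_pt q)) => x [/Sq]; exact.
  by exists p => //; apply: leq_trans le_jk.
have [eq_a|/lt_total [lt_a|lt_a]] := pselect (q.1.1 = q'.1.1); last 2 first.
- right; left=> x qx [[i' Ex]|[i' ->]]; last by exists i'.
  case: qx => -[i]; rewrite Ex; [move=> [Ea _ _] | move=> Ex'].
    by case: (@lt_irr q.1.1); rewrite -{2}Ea.
  by have [] := qV i; rewrite -Ex' => /lt_asym.
- left=> x [[i Ex]|[i ->]]; last by exists i.
  case=> -[i']; rewrite Ex; [move=> [Ea _ _] | move=> Ex'].
    by case: (@lt_irr q.1.1); rewrite {1}Ea.
  by have [] := q'V i'; rewrite -Ex' => /lt_asym.
have [eq_ly|neq_ly] := pselect (q.1.2 = q'.1.2); last first.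
  left=> x [[i Ex]|[i ->]]; last by exists i.
  case=> -[i']; rewrite Ex; [move=> [_ /hI //] | move=> Ex'].
  by have [] := q'V i'; rewrite -Ex' -eq_a => /lt_irr.
right; right=> x [[i ->]|[i Ex]]; first by exists i.
case=> -[i']; rewrite Ex => Ex'; have [lt_i r_i] := qV i.
  by move: lt_i; rewrite Ex' eq_a => /lt_irr.
(* A common old point has only one place in the shared guess, so the tuples agree. *)
case: neq_q; move: r_i; rewrite Ex' {1}eq_ly => /(_ _ erefl) [eq_p _].
by case: q q' {qV q'V lt_i Ex Ex' i} eq_a eq_ly eq_p => [[a ly] p] [[a' ly'] p'] /= -> -> ->.
Qed.

Context (l0 : L) (code : D -> L) (codeI : injective code).

(* Every colouring [phi] of a power [C -> L] has a fibre mapping onto [L]: if the coordinate-[z]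
   projection of each fibre of colour [z] missed a value [u z], then [u] could have no colour. *)
Lemma exists_large_fibre (phi : (C -> L) -> C) :
  exists z, exists delta : L -> C -> L, injective delta /\ forall l, phi (delta l) = z.
Proof.
have [z zP] : exists z, forall l, exists d : C -> L, phi d = z /\ d z = l.
  apply: contrapT => nz.
  have [u uP] : {u : C -> L & forall z d, phi d = z -> d z <> u z}.
    apply: (@choice _ _ (fun z l => forall d, phi d = z -> d z <> l)) => z.
    apply: contrapT => nl; apply: nz; exists z => l.
    apply: contrapT => nd; apply: nl; exists l => d phid dz.
    by apply: nd; exists d.
  exact: (uP _ u erefl erefl).
have [delta deltaP] := choice zP; exists z, delta; split=> [l l' eq_d|l].
  by rewrite -(proj2 (deltaP l)) eq_d (proj2 (deltaP l')).
exact: (proj1 (deltaP l)).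
Qed.

Lemma layered_not_cf : 0 < j -> j <= k -> ~ card_le L C ->
  ~ exists f : X -> C, cf_coloring (fun q : {q | valid_index q} => layered_set (sval q)) f.
Proof.
move=> j_gt0 le_jk nLC [f fcf]; apply: nLC.
pose relevant a z := exists iota : L -> X,
  injective iota /\ forall l, f (iota l) = z /\ lt (iota l).1.1 a.
suff new_color a : exists z, ~ relevant a z /\ exists iota : L -> X,
    injective iota /\ forall l, f (iota l) = z /\ (iota l).1.1 = a.
  have [z zP] := choice new_color; exists z => a b eq_z; apply: contrapT => /lt_total.
  wlog lt_ab : a b eq_z / lt a b.
    by move=> th [lt_ab|lt_ba]; [apply: (th a b) | apply: (th b a)] => //; left.
  move=> _; have [nrel _] := zP b; apply: nrel.
  have [_ [iota [iotaI iotaP]]] := zP a; exists iota; split=> // l.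
  by have [-> ->] := iotaP l.
have [iota iotaP] : {iota : C -> L -> X & forall z, relevant a z ->
    injective (iota z) /\ forall l, f (iota z l) = z /\ lt (iota z l).1.1 a}.
  apply: (@choice _ _ (fun z iota => relevant a z -> injective iota /\
    forall l, f (iota l) = z /\ lt (iota l).1.1 a)) => z.
  have [[iota iotaP]|nrel] := pselect (relevant a z); first by exists iota.
  by exists (fun l => (l, l, Ordinal j_gt0)).
(* [rep] fixes every [i < j] and sends the other indices to 0. *)
pose rep (i : 'I_k) : 'I_j := insubd (Ordinal j_gt0) (i : nat).
(* Values at irrelevant [p] are put at level [a] itself, out of the way of those of level below [a]. *)
pose r (b : D) : X := if pselect (forall i, relevant a (b.1 i)) then iota (b.1 (rep b.2)) (code b)
  else (a, l0, Ordinal j_gt0).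
have rE p i : (forall i, relevant a (p i)) -> r (p, i) = iota (p (rep i)) (code (p, i)).
  by rewrite /r /=; case: pselect.
(* Equal values of [r] have equal colours, so they come from the same [iota z]; injectivity of
   [iota z] and of [code] then identifies the arguments. *)
have rV d p : (forall i, relevant a (p i)) -> valid_index (a, (d, r), p).
  move=> rel_p i; rewrite /old_pt /= rE //.
  have [iI iP] := iotaP _ (rel_p (rep i)); have [f_i lt_i] := iP (code (p, i)).
  split=> // -[p' i']; have [rel_p'|nrel_p'] := pselect (forall i, relevant a (p' i)); last first.
    by rewrite /r /=; case: pselect => //= _ Er; move: lt_i; rewrite -Er => /lt_irr.
  rewrite rE // => Er; apply: codeI; apply: iI; rewrite -Er; congr iota.
  have [_ iP'] := iotaP _ (rel_p' (rep i')).
  by rewrite -f_i -Er (proj1 (iP' _)).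
have irrelevant d : exists i, ~ relevant a (f (a, h (d, r), i)).
  apply: contrapT => all_rel; pose p i := f (a, h (d, r), i).
  have rel_p i : relevant a (p i) by apply: contrapT => nrel; apply: all_rel; exists i.
  pose q : index := (a, (d, r), p).
  have qV : valid_index q by exact: rV.
  have f_old i : f (old_pt q i) = p (rep i).
    rewrite /old_pt /= rE //; have [_ iP] := iotaP _ (rel_p (rep i)).
    exact: (proj1 (iP _)).
  have neq i i' : new_pt q i = old_pt q i' -> False.
    by move=> eq_x; have [] := qV i'; rewrite -eq_x => /lt_irr.
  have [z /has_card1 [x [[qx fx] x_uniq]]] := fcf (exist _ q qV).
  (* No colour occurs just once: new point [i] shares its colour with old point [i], which exists as
     [j <= k], and old point [i] with new point [rep i]. *)
  case: qx => /= -[i Ex]; rewrite Ex in fx x_uniq.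
    pose i' := widen_ord le_jk i.
    have rep_i : rep i' = i by apply: val_inj; rewrite /rep val_insubd /= ltn_ord.
    case: (@neq i i'); symmetry; apply: x_uniq; split; first by right; exists i'.
    by rewrite f_old rep_i -fx.
  case: (@neq (rep i) i); apply: x_uniq; split; first by left; exists (rep i).
  by rewrite -fx f_old.
have [i iP] := choice irrelevant.
(* Each label [d] yields a new point of irrelevant colour; a large fibre of this colouring of the
   labels gives |L| such points of one colour. *)
have [z [delta [deltaI deltaP]]] := exists_large_fibre (fun d => f (a, h (d, r), i d)).
exists z; split; first by rewrite -(deltaP l0); exact: iP.
exists (fun l => (a, h (delta l, r), i (delta l))); split=> // l l' [/hI [/deltaI]] //.
Qed.

End LayeredSystem.

(** The supremum is at least mu once it exceeds every |C| < mu, hence the quantification over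
    [C]. *)
Theorem theorem3p7 (L M : Type) (k t : nat) :
  infinite_type L -> infinite_type M -> pow_lt_eq L M ->
  0 < k -> k < t -> t <= 2 * k ->
  forall C : Type, card_lt C M ->
  exists (X : Type) (A : L -> X -> Prop),
    is_system A t k.+1 /\ (forall x : X, exists i, A i x) /\
    ~ exists f : X -> C, cf_coloring A f.
Proof.
move=> Linf Minf LM k_gt0 lt_kt le_t2k C ltCM.
have L2 := infinite_neq Linf; have [l0 _] := L2.
have L1 : inhabited L by exists.
have L_ord n : card_le ('I_n -> L) L by apply/LM/infinite_card_lt_ord.
have CL := LM C ltCM.
pose j := t - k.
have j_gt0 : 0 < j by rewrite subn_gt0.
have le_jk : j <= k by rewrite leq_subLR addnn -mul2n.
have tE : t = j + k by rewrite subnK // ltnW.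
have ord_le n : card_le 'I_n L by exact: pow_le_card.
have DL : card_le (('I_j -> C) * 'I_k -> L) L by apply: pow_le_prod => //; exact: pow_le_tuple.
have XL : card_le (L * L * 'I_j) L.
  by apply: card_le_prod => //; apply: card_le_prod => //; exists id.
(* Labels: |L^C| <= |L| since |C| < mu. Guesses: |X^D| <= |L^D| <= |L|. *)
have [h hI] : card_le ((C -> L) * (('I_j -> C) * 'I_k -> L * L * 'I_j)) L.
  apply: card_le_prod => //; apply: card_le_trans DL; exact: card_le_codomain.
have [code codeI] := pow_le_card L2 DL.
have [lt [lt_asym lt_total]] := exists_tournament L.
apply: (@extend_system L {q | valid_index lt q} _ C
  (fun q => layered_set h (sval q))) => //.
- apply: card_le_trans (card_le_sig _) _; apply: card_le_prod => //; last first.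
    by apply: pow_le_card => //; exact: pow_le_tuple.
  apply: card_le_prod => //; by [exists id | exists h].
- by move=> [q qV]; rewrite tE; exact: (layered_set_card lt_asym h qV).
- move=> [q qV] [q' q'V] neq_q.
  apply: (layered_set_inter lt_asym lt_total hI le_jk qV q'V) => eq_q.
  by apply: neq_q; apply: eq_exist.
exact: (layered_not_cf lt_asym lt_total hI l0 codeI j_gt0 le_jk (pow_le_Cantor L2 CL)).
Qed.
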